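(* Let $i,j,n\in\mathbb{N}$ with $0<i<j<n$ and $j\neq 2i$, and let $f:\mathbb{F}_{2^n}\to\mathbb{F}_{2^n}$ be given by $f(x)=x^{2^j+2^i+1}$. Suppose $f$ has optimal second-order differential uniformity, i.e. $\delta^2(f)=4$. If $n$ is odd, then $\gcd(i,n)=\gcd(j,n)=\gcd(j-i,n)=1$. If $n$ is even, then one of the three numbers $\gcd(i,n),\gcd(j,n),\gcd(j-i,n)$ equals $2$, and the other two equal $1$.
   Context: $\mathbb{N}=\{1,2,3,\dots\}$; $\mathbb{F}_{2^n}$ is the finite field with $2^n$ elements and $\mathbb{F}_{2^n}^*$ its set of non-zero elements. For $f:\mathbb{F}_{2^n}\to\mathbb{F}_{2^n}$ and $a\in\mathbb{F}_{2^n}^*$, the discrete derivative is $D_af(x)=f(x+a)-f(x)$, and $D^{(2)}_{a,b}f=D_aD_bf$, i.e. $D^{(2)}_{a,b}f(x)=f(x)+f(x+a)+f(x+b)+f(x+a+b)$. The second-order differential uniformity of $f$ is $$\delta^2(f)=\max_{a,b\in\mathbb{F}_{2^n}^*,\ a\neq b,\ c\in\mathbb{F}_{2^n}}\left|\{x\in\mathbb{F}_{2^n} : D^{(2)}_{a,b}f(x)=c\}\right|.$$ The function $f$ is said to have optimal second-order differential uniformity if $\delta^2(f)=4$. *)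

(* Defs.v *)
From mathcomp Require Import all_boot all_algebra.

Set Implicit Arguments.
Unset Strict Implicit.
Unset Printing Implicit Defensive.

Import GRing.Theory.
Local Open Scope ring_scope.

Definition discrete_derivative (F : finFieldType) (a : F) (f : F -> F) : F -> F :=
  fun x => f (x + a) - f x.

Definition second_derivative (F : finFieldType) (a b : F) (f : F -> F) : F -> F :=
  discrete_derivative a (discrete_derivative b f).

Definition second_order_differential_uniformity
    (F : finFieldType) (f : F -> F) : nat :=
  \max_(a : F | a != 0%R) \max_(b : F | (b != 0%R) && (a != b)) \max_(c : F)
    #|[set x : F | second_derivative a b f x == c]|.

(* The value 4 is optimal for fields of characteristic 2, the only ones for
   which this predicate is meant to be used. *)
Definition optimal_second_order_differential_uniformity
    (F : finFieldType) (f : F -> F) : Prop :=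
  second_order_differential_uniformity f = 4%N.

(* Main.v *)
Require Import Defs.
From mathcomp Require Import all_boot all_algebra.
From mathcomp Require Import finfield ring zify.

(** In characteristic 2 the map [D_a D_b f] is, up to an additive constant,
    [x |-> det (v a, v b, v x)] with [v x := (x, x ^ 2^i, x ^ 2^j)].  Take
    [a = 1].  If two of the three coordinates of [v] agree at [b] and at [x]
    (they always agree at [1]), the determinant vanishes.  So let [d] be one of
    the three gcds, with [d >= 2], and pick [b <> 0, 1] in the subfield of order
    [2^d]: then [D_1 D_b f] is constant on that subfield, whence [2^d <= 4].  If
    [n], [i] and [j] were all even, an element [b] of [F_4 \ F_2] would make
    [D_1 D_b f] constant on the whole field.  Parity then decides which gcd
    equals 2. *)

Set Implicit Arguments.
Unset Strict Implicit.
Unset Printing Implicit Defensive.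

Import GRing.Theory.
Local Open Scope ring_scope.

Lemma expn_fixed_dvd (R : pzSemiRingType) (p d m : nat) (x : R) :
  (d %| m)%N -> x ^+ (p ^ d) = x -> x ^+ (p ^ m) = x.
Proof.
case/dvdnP=> k -> xd; elim: k => [|k IHk]; first by rewrite expr1.
by rewrite mulSn expnD exprM xd.
Qed.

(** Induction on [n / d]: since raising to the power [p ^ d] is additive, [X^(p^((k+1)d)) - X] is
    the [p ^ d]-th power of [X^(p^(kd)) - X] plus [X^(p^d) - X]. *)
Lemma dvdp_XnsubX_dvdn (F : fieldType) (p d n : nat) : p \in [pchar F] -> (d %| n)%N ->
  ('X^(p ^ d) - 'X : {poly F}) %| 'X^(p ^ n) - 'X.
Proof.
move=> pF /dvdnP[k ->]; elim: k => [|k IHk]; first by rewrite expr1 subrr dvdp0.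
have pq : [pchar {poly F}].-nat (p ^ d)%N.
  by rewrite pnatX pnatE ?(pcharf_prime pF) // (pchar_poly F p) pF.
have -> : 'X^(p ^ (k.+1 * d)) - 'X
    = ('X^(p ^ (k * d)) - 'X) ^+ (p ^ d) + ('X^(p ^ d) - 'X) :> {poly F}.
  by rewrite exprDn_pchar // exprNn_pchar // -exprM -expnD mulSnr; ring.
apply: dvdp_add => //; apply: dvdp_trans IHk _.
by rewrite dvdp_exp // expn_gt0 prime_gt0 ?(pcharf_prime pF).
Qed.

(** [X^(p^d) - X] divides [X^#|F| - X], the product of all [X - x] with [x] in [F]. It therefore
    splits with distinct roots, and its degree counts them. *)
Lemma card_expn_fixed (F : finFieldType) (p d n : nat) :
  prime p -> #|F| = (p ^ n)%N -> (0 < d)%N -> (d %| n)%N ->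
  #|[set x : F | x ^+ (p ^ d) == x]| = (p ^ d)%N.
Proof.
move=> pp cF d0 dn.
have := dvdp_XnsubX_dvdn (card_finPcharP cF pp) dn.
rewrite -cF finField_genPoly => /dvdp_prod_XsubC[m Em].
have q1 : (1 < p ^ d)%N by rewrite -(exp1n d) ltn_exp2r ?prime_gt1.
have mem x : (x ^+ (p ^ d) == x) = (x \in mask m (index_enum F)).
  rewrite -root_prod_XsubC -(eqp_root Em) rootE.
  by rewrite !hornerE subr_eq0.
have := eqp_size Em; rewrite size_prod_XsubC size_polyDl; last first.
  by rewrite size_polyN size_polyX size_polyXn.
rewrite size_polyXn => -[sz]; rewrite [RHS]sz -(card_uniqP _).
  by apply: eq_card => x; rewrite inE mem.
exact/mask_uniq/index_enum_uniq.
Qed.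

(** The right-hand side is [det (v 1, v b, v x)] expanded after subtracting the
    first column from the other two. *)
Lemma second_derivative_cubicE (F : finFieldType) (i j : nat) (b x : F) :
  2%N \in [pchar F] ->
  let D := second_derivative 1 b (fun y : F => y ^+ (2 ^ j + 2 ^ i + 1)) in
  D x - D 0 = (b ^+ (2 ^ i) - b) * (x ^+ (2 ^ j) - x)
            - (b ^+ (2 ^ j) - b) * (x ^+ (2 ^ i) - x).
Proof.
move=> char2.
have p2 k : [pchar F].-nat (2 ^ k)%N by rewrite pnatX pnatE ?char2.
have two0 : 2%:R = 0 :> F by exact: pcharf0 char2.
have z0 k : 0 ^+ (2 ^ k) = 0 :> F by rewrite expr0n expn_eq0.
rewrite /second_derivative /discrete_derivative /= !exprD !expr1.
rewrite !exprDn_pchar // !expr1n !z0.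
set bi := b ^+ (2 ^ i); set bj := b ^+ (2 ^ j).
set xi := x ^+ (2 ^ i); set xj := x ^+ (2 ^ j).
apply/eqP; rewrite -subr_eq0; apply/eqP.
(* Over the integers the two sides differ by exactly twice this sum, so [ring] needs no knowledge of
   the characteristic. *)
transitivity (2%:R * (bi * x + b * xj + bj * xi)); first by ring.
by rewrite two0 mul0r.
Qed.

Lemma card_second_derivative_const (F : finFieldType) (g : F -> F) (A : {set F})
    (a b c : F) :
  optimal_second_order_differential_uniformity g ->
  a != 0 -> b != 0 -> a != b ->
  {in A, forall x, second_derivative a b g x = c} -> (#|A| <= 4)%N.
Proof.
move=> <- a0 b0 ab Ac; rewrite /second_order_differential_uniformity.
rewrite (bigD1 a) //= leq_max (bigD1 b) ?b0 //= leq_max (bigD1 c) //= leq_max.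
by rewrite subset_leq_card //; apply/subsetP=> x /Ac; rewrite inE => ->.
Qed.

Lemma exists_fixed_neq01 (F : finFieldType) (d n : nat) :
  #|F| = (2 ^ n)%N -> (1 < d)%N -> (d %| n)%N ->
  exists b : F, [/\ b != 0, 1 != b & b ^+ (2 ^ d) = b].
Proof.
move=> cF d1 dn.
have := card_expn_fixed (isT : prime 2) cF (ltnW d1) dn.
set A := [set _ | _] => cA.
have /subsetPn[b] : ~~ (A \subset [set 0; 1]).
  apply/negP=> /subset_leq_card; rewrite cA cards2 => h.
  have : (2 ^ 2 <= 2 ^ d)%N by rewrite leq_exp2l.
  by move/leq_trans/(_ h); case: (_ != _).
rewrite !inE negb_or => /eqP bd /andP[b0 b1].
by exists b; rewrite b0 eq_sym b1.
Qed.

Section OptimalCubic.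
Variables (F : finFieldType) (i j n : nat).
Hypothesis cardF : #|F| = (2 ^ n)%N.
Hypothesis optimal_f : optimal_second_order_differential_uniformity
  (fun x : F => x ^+ (2 ^ j + 2 ^ i + 1)).

(** The equation makes the determinant vanish, so [D_1 D_b f] keeps its value at 0 on all of [A],
    which thus lies in a single fibre. *)
Lemma optimal_card_le4 (A : {set F}) (b : F) : b != 0 -> 1 != b ->
  {in A, forall x, (b ^+ (2 ^ i) - b) * (x ^+ (2 ^ j) - x)
                 = (b ^+ (2 ^ j) - b) * (x ^+ (2 ^ i) - x)} ->
  (#|A| <= 4)%N.
Proof.
move=> b0 b1 Ab; have char2 := card_finPcharP cardF (isT : prime 2).
pose c := second_derivative 1 b (fun y : F => y ^+ (2 ^ j + 2 ^ i + 1)) 0.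
apply: (card_second_derivative_const (c := c) optimal_f (oner_neq0 F) b0 b1) =>
  x /Ab xb.
by apply: subr0_eq; rewrite second_derivative_cubicE // xb subrr.
Qed.

Lemma optimal_dvd_le2 (d : nat) : (i <= j)%N -> (0 < d)%N -> (d %| n)%N ->
  [\/ d %| i, d %| j | d %| j - i]%N -> (d <= 2)%N.
Proof.
move=> ij d0 dn dij; rewrite leqNgt; apply/negP=> d3.
have [b [b0 b1 bd]] := exists_fixed_neq01 cardF (ltnW d3) dn.
suff : (#|[set x : F | x ^+ (2 ^ d) == x]| <= 2 ^ 2)%N.
  by rewrite (card_expn_fixed _ cardF) // leq_exp2l // leqNgt d3.
apply: (optimal_card_le4 b0 b1) => x; rewrite inE => /eqP xd.
(* If [d] divides [i] or [j], one factor on each side is zero. If [d] divides [j - i], then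
   [x^(2^j) = (x^(2^(j-i)))^(2^i) = x^(2^i)], likewise for [b], and the two sides coincide. *)
case: dij => h.
- by rewrite !(expn_fixed_dvd h) // !subrr mul0r mulr0.
- by rewrite !(expn_fixed_dvd h) // !subrr mul0r mulr0.
by rewrite -(subnK ij) expnD !exprM !(expn_fixed_dvd h).
Qed.

Lemma optimal_not_all_even : (2 < n)%N -> ~ [/\ 2 %| n, 2 %| i & 2 %| j]%N.
Proof.
move=> n3 [n2 i2 j2].
have [b [b0 b1 bd]] := exists_fixed_neq01 cardF (isT : 1 < 2)%N n2.
suff : (#|[set: F]| <= 2 ^ 2)%N by rewrite cardsT cardF leq_exp2l // leqNgt n3.
apply: (optimal_card_le4 b0 b1) => x _.
by rewrite (expn_fixed_dvd i2 bd) (expn_fixed_dvd j2 bd) subrr !mul0r.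
Qed.

End OptimalCubic.

Close Scope ring_scope.

Theorem proposition4p1 (n i j : nat) (F : finFieldType)
    (hF : #|F| = 2 ^ n)
    (hi : 0 < i) (hij : i < j) (hjn : j < n) (hj2i : j <> 2 * i)
    (hopt : optimal_second_order_differential_uniformity
              (fun x : F => (x ^+ (2 ^ j + 2 ^ i + 1))%R)) :
  (odd n -> gcdn i n = 1 /\ gcdn j n = 1 /\ gcdn (j - i) n = 1) /\
  (~~ odd n ->
     (gcdn i n = 2 /\ gcdn j n = 1 /\ gcdn (j - i) n = 1) \/
     (gcdn i n = 1 /\ gcdn j n = 2 /\ gcdn (j - i) n = 1) \/
     (gcdn i n = 1 /\ gcdn j n = 1 /\ gcdn (j - i) n = 2)).
Proof.
have n0 : 0 < n by lia.
have le2 k : k \in [:: i; j; j - i] -> gcdn k n <= 2.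
  move=> hk; apply: (optimal_dvd_le2 hF hopt (ltnW hij)).
  - by rewrite gcdn_gt0 n0 orbT.
  - exact: dvdn_gcdr.
  move: hk; rewrite !inE => /or3P[] /eqP->;
    [constructor 1|constructor 2|constructor 3]; exact: dvdn_gcdl.
(* A gcd that is 1 or 2 is determined by its parity. *)
have gcdE k : k \in [:: i; j; j - i] ->
    gcdn k n = if odd k || odd n then 1 else 2.
  move=> /le2 h; have : 0 < gcdn k n by rewrite gcdn_gt0 n0 orbT.
  have : (2 %| gcdn k n) = ~~ (odd k || odd n).
    by rewrite dvdn_gcd !dvdn2 negb_or.
  by case: (_ || _) h; case: gcdn => [|[|[|]]].
rewrite !gcdE ?inE ?eqxx ?orbT //.
have := optimal_not_all_even hF hopt (leq_ltn_trans (leq_ltn_trans hi hij) hjn).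
rewrite !dvdn2 oddB ?(ltnW hij) //.
case: (odd n) => [|h]; first by rewrite !orbT.
split=> // _; move: h.
(* For even [n], the gcd equal to 2 is that of [j - i] if [i] and [j] are both odd, and otherwise
   that of the only even one among them; both even is excluded. *)
by case: (odd i); case: (odd j) => //= h; [do 2 right|right; left|left|case: h].
Qed.
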